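(* Fix $B>\pi\left(\tfrac{2}{3}\right)^{1/2}$. Then there is $n_0=n_0(B)$, independent of the dimension $d\ge 2$, such that $$c_n\le b_{n+1}e^{B\sqrt{n}}\le \mu^{n+1}e^{B\sqrt{n}}\qquad\text{for all } n\ge n_0 .$$
   Context: An $n$-step self-avoiding walk (SAW) on $\mathbb{Z}^d$ is a sequence $\omega=(\omega(0),\dots,\omega(n))$ of pairwise distinct points of $\mathbb{Z}^d$ with $\|\omega(j)-\omega(j-1)\|_1=1$ for $j=1,\dots,n$. $c_n$ is the number of $n$-step SAWs with $\omega(0)=0$, and $\mu=\lim_{n\to\infty}c_n^{1/n}$ is the connective constant (both depend on $d$). Write $\omega_1(i)$ for the first coordinate of $\omega(i)$. An $n$-step bridge is an $n$-step SAW with $\omega_1(0)<\omega_1(i)\le\omega_1(n)$ for $i=1,\dots,n$. $b_n$ is the number of $n$-step bridges with $\omega(0)=0$ for $n\ge 1$, and $b_0=1$. *)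

(* Defs.v *)
From HB Require Import structures.
From mathcomp Require Import all_boot all_order all_algebra finmap.
From mathcomp Require Import all_classical all_reals all_analysis.
Set Implicit Arguments.
Unset Strict Implicit.
Unset Printing Implicit Defensive.
Import Order.TTheory GRing.Theory Num.Theory.
Import numFieldNormedType.Exports.
Local Open Scope classical_set_scope.
Local Open Scope ring_scope.

Definition l1norm (d : nat) (x : 'rV[int]_d) : int := \sum_(i < d) `|x 0 i|.

(* In dimension 0 there is no first coordinate; the value 0 is a dummy. *)
Definition first_coord (d : nat) : 'rV[int]_d -> int :=
  if d is d'.+1 return 'rV[int]_d -> int then fun x => x 0 ord0 else fun=> 0.

Definition is_saw (d n : nat) (w : {ffun 'I_n.+1 -> 'rV[int]_d}) : Prop :=
  injective w /\
  forall i j : 'I_n.+1, j = i.+1 :> nat -> l1norm (w j - w i) = 1.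

Definition is_bridge (d n : nat) (w : {ffun 'I_n.+1 -> 'rV[int]_d}) : Prop :=
  is_saw w /\
  forall i : 'I_n.+1, (0 < i)%N ->
    first_coord (w ord0) < first_coord (w i) /\
    first_coord (w i) <= first_coord (w ord_max).

Definition saws (d n : nat) : set {ffun 'I_n.+1 -> 'rV[int]_d} :=
  [set w | is_saw w /\ w ord0 = 0].
Arguments saws : clear implicits.

Definition bridges (d n : nat) : set {ffun 'I_n.+1 -> 'rV[int]_d} :=
  [set w | is_bridge w /\ w ord0 = 0].
Arguments bridges : clear implicits.

(* [fset_set] sends infinite sets to the empty one, so the two counts below
   are meaningful only because of the finiteness proved here. *)
Lemma finite_saws (d n : nat) : finite_set (saws d n).
Proof.
pose f (u : {ffun 'I_n.+1 -> 'rV['I_(n + n).+1]_d}) :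
    {ffun 'I_n.+1 -> 'rV[int]_d} :=
  [ffun k => \row_i ((u k 0 i : nat)%:Z - n%:Z)].
apply: (@sub_finite_set _ _ (f @` setT)); last first.
  by apply: finite_image; exact: finite_finset.
move=> w [[_ wstep] w0].
have bnd (k : nat) (kn : (k < n.+1)%N) i : `|w (Ordinal kn) 0 i| <= k%:Z.
  elim: k kn => [|k IH] kn.
    have -> : Ordinal kn = ord0 by exact: val_inj.
    by rewrite w0 mxE normr0.
  have kn' := ltnW kn.
  have := wstep (Ordinal kn') (Ordinal kn) erefl.
  rewrite /l1norm (bigD1 i) //= => step.
  have step1 : `|w (Ordinal kn) 0 i - w (Ordinal kn') 0 i| <= 1.
    rewrite -step !mxE lerDl; exact: sumr_ge0.
  rewrite -(subrK (w (Ordinal kn') 0 i) (w (Ordinal kn) 0 i)).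
  by rewrite (le_trans (ler_normD _ _)) // intS lerD.
exists [ffun k => \row_i inord (absz (w k 0 i + n%:Z))] => //.
apply/ffunP => k; apply/rowP => i; rewrite !ffunE !mxE.
have : `|w k 0 i| <= n%:Z.
  case: k => k kn; apply: le_trans (bnd k kn i) _.
  by rewrite lez_nat -ltnS.
rewrite ler_norml => /andP[lo hi].
have ge0 : 0 <= w k 0 i + n%:Z by rewrite -lerBlDr sub0r.
rewrite inordK ?gez0_abs ?addrK //.
by rewrite ltnS -lez_nat gez0_abs // PoszD lerD2r.
Qed.

Lemma finite_bridges (d n : nat) : finite_set (bridges d n).
Proof.
by apply: sub_finite_set (finite_saws d n) => w [[]].
Qed.

Definition saw_count (d n : nat) : nat := #|` fset_set (saws d n)|.

Definition bridge_count (d n : nat) : nat :=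
  if n is 0 then 1%N else #|` fset_set (bridges d n)|.

(* [limn] is a total operator: that this sequence converges (by
   submultiplicativity of the counts) is not part of the definition. *)
Definition connective_constant (R : realType) (d : nat) : R :=
  limn (fun n : nat => (saw_count d n)%:R `^ n%:R^-1 : R).

(* Main.v *)
Require Import Defs.
From HB Require Import structures.
From mathcomp Require Import all_boot all_order all_algebra finmap.
From mathcomp Require Import all_classical all_reals all_analysis.
From mathcomp Require Import zify ring lra.
Import Order.TTheory GRing.Theory Num.Theory.
Import numFieldNormedType.Exports.
Local Open Scope classical_set_scope.
Local Open Scope ring_scope.

(** Hammersley-Welsh. Cutting a self-avoiding walk at its last visit to its
    minimal first coordinate splits it into two half-space walks. A half-space
    walk is unfolded into a bridge by reflecting it repeatedly after its last
    visit to its maximal height: each reflection raises the height by the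
    descent following that maximum, and the successive descents strictly
    decrease. Weighting a walk of height [A] by [z ^+ A] therefore bounds the
    number of half-space walks by [z ^+ n * \prod_k (1 + z ^- k)] times the
    number of bridges, where the product is the generating function of
    partitions into distinct parts. Euler's identity, the series of
    [- ln (1 - y)] and [\sum_j j ^- 2 <= pi ^+ 2 / 6] give
    [\prod_k (1 + expR t ^- k) <= expR (pi ^+ 2 / (12 * t))], and the choice
    [t = pi / Num.sqrt (6 * n.+1)] yields [pi * Num.sqrt (2 / 3)] in the
    exponent. *)

(** * Self-avoiding walks as step sequences *)

Lemma ler_sum_subset (R : numDomainType) (U : eqType) (zs ys : seq U)
    (G : U -> R) :
  uniq zs -> {subset zs <= ys} -> (forall y, y \in ys -> 0 <= G y) ->
  \sum_(y <- zs) G y <= \sum_(y <- ys) G y.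
Proof.
elim: zs ys => [|z zs IH] ys /=.
  by move=> _ _ G0; rewrite big_nil big_seq sumr_ge0.
case/andP=> zzs uzs sub G0.
have zys : z \in ys by apply: sub; rewrite mem_head.
rewrite big_cons (big_rem z zys) /= lerD2l; apply: IH => // [y yzs|y yin].
  rewrite rem_mem ?sub ?inE ?yzs ?orbT //.
  by apply: contraNneq zzs => <-.
by apply: G0; apply: mem_rem yin.
Qed.

(** Turns each injection between families of walks constructed below into an inequality between
    weighted counts. *)
Lemma ler_sum_inj (R : numDomainType) (T U : eqType) (xs : seq T) (ys : seq U)
    (P : pred T) (Q : pred U) (f : T -> U) (F : T -> R) (G : U -> R) :
  uniq xs -> (forall y, 0 <= G y) ->
  {in [pred x | (x \in xs) && P x] &, injective f} ->
  (forall x, x \in xs -> P x -> [/\ f x \in ys, Q (f x) & F x <= G (f x)]) ->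
  \sum_(x <- xs | P x) F x <= \sum_(y <- ys | Q y) G y.
Proof.
move=> uxs G0 finj fP; rewrite -[X in X <= _]big_filter -[X in _ <= X]big_filter.
have memE x : x \in [seq x <- xs | P x] = (x \in xs) && P x.
  by rewrite mem_filter andbC.
apply: (@le_trans _ _ (\sum_(y <- [seq f x | x <- [seq x <- xs | P x]]) G y)).
  rewrite big_map big_seq [X in _ <= X]big_seq; apply: ler_sum => x.
  by rewrite memE => /andP[xin Px]; case: (fP x xin Px).
apply: ler_sum_subset => //.
  rewrite map_inj_in_uniq ?filter_uniq // => x y.
  by rewrite !memE => xP yP; apply: finj; rewrite inE.
move=> _ /mapP[x + ->]; rewrite memE => /andP[xin Px].
by rewrite mem_filter; case: (fP x xin Px) => -> ->.
Qed.

Section Walks.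
Variable d : nat.
Let V := 'rV[int]_d.+1.

(* [(i, b)] is the unit step [(-1)^b e_i]; a walk from the origin is the
   sequence of its steps. *)
Definition step : finType := ('I_d.+1 * bool)%type.

Definition stepv (e : step) : V := (-1) ^+ e.2 *: delta_mx 0 e.1.

Definition vsum (s : seq step) : V := \sum_(e <- s) stepv e.

Definition pos (s : seq step) (i : nat) : V := vsum (take i s).

Definition ht (s : seq step) (i : nat) : int := pos s i 0 ord0.

Definition up : step := (ord0, false).

(** The action on steps of the reflection [mir] of points: only steps along the first axis change
    sign. *)
Definition flip (e : step) : step := (e.1, e.2 (+) (e.1 == ord0)).

Definition opps (e : step) : step := (e.1, ~~ e.2).

Definition mir (v : V) : V := \row_i (if i == ord0 then - v 0 i else v 0 i).

Lemma mirK : involutive mir.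
Proof.
by move=> v; apply/rowP => i; rewrite !mxE; case: eqP => // _; rewrite opprK.
Qed.

Lemma flipK : involutive flip.
Proof. by move=> [i b]; rewrite /flip /=; congr pair; case: b; case: eqP. Qed.

Lemma oppsK : involutive opps.
Proof. by move=> [i b]; rewrite /opps /= negbK. Qed.

Lemma vsum_cat s1 s2 : vsum (s1 ++ s2) = vsum s1 + vsum s2.
Proof. exact: big_cat. Qed.

Lemma mirD u v : mir (u + v) = mir u + mir v.
Proof. by apply/rowP => i; rewrite !mxE; case: ifP => // _; rewrite opprD. Qed.

Lemma stepv_flip e : stepv (flip e) = mir (stepv e).
Proof.
apply/rowP => i; case: e => j b; rewrite !mxE /=.
case: (eqVneq i j) => [->|ij] /=; last by rewrite !mulr0 oppr0 if_same.
by case: (j == ord0); case: b => /=; rewrite ?expr0 ?expr1 ?mulr1 ?opprK.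
Qed.

Lemma vsum_flip s : vsum (map flip s) = mir (vsum s).
Proof.
rewrite /vsum big_map; elim: s => [|e s IH].
  by rewrite !big_nil; apply/rowP => i; rewrite !mxE oppr0 if_same.
by rewrite !big_cons IH stepv_flip mirD.
Qed.

Lemma vsum_opps s : vsum (map opps s) = - vsum s.
Proof.
rewrite /vsum big_map -sumrN; apply: eq_bigr => -[i b] _.
by rewrite /stepv /=; case: b; rewrite /= ?expr0 ?expr1 !scaleN1r ?scale1r ?opprK.
Qed.

Lemma vsum_rev s : vsum (rev s) = vsum s.
Proof. by apply: perm_big; rewrite perm_rev. Qed.

Lemma pos0 s : pos s 0 = 0.
Proof. by rewrite /pos take0 /vsum big_nil. Qed.

Lemma ht0 s : ht s 0 = 0.
Proof. by rewrite /ht pos0 mxE. Qed.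

Lemma pos_size s : pos s (size s) = vsum s.
Proof. by rewrite /pos take_size. Qed.

Lemma posD s k i : pos s (k + i) = pos s k + pos (drop k s) i.
Proof. by rewrite /pos takeD vsum_cat. Qed.

Lemma htD s k i : ht s (k + i) = ht s k + ht (drop k s) i.
Proof. by rewrite /ht posD mxE. Qed.

Lemma pos_take s k i : (i <= k)%N -> pos (take k s) i = pos s i.
Proof. by move=> ik; rewrite /pos take_takel. Qed.

Lemma pos_catl s1 s2 i : (i <= size s1)%N -> pos (s1 ++ s2) i = pos s1 i.
Proof. by move=> ik; rewrite /pos takel_cat. Qed.

Lemma pos_catr s1 s2 i : pos (s1 ++ s2) (size s1 + i) = vsum s1 + pos s2 i.
Proof. by rewrite posD pos_catl // pos_size drop_size_cat. Qed.

Lemma pos_flip s i : pos (map flip s) i = mir (pos s i).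
Proof. by rewrite /pos -map_take vsum_flip. Qed.

Lemma ht_flip s i : ht (map flip s) i = - ht s i.
Proof. by rewrite /ht pos_flip mxE eqxx. Qed.

Lemma pos_rev s i : (i <= size s)%N ->
  pos (rev (map opps s)) i = pos s (size s - i) - vsum s.
Proof.
move=> isz; rewrite {1}/pos take_rev size_map vsum_rev -map_drop vsum_opps.
rewrite -[in vsum s](cat_take_drop (size s - i) s) vsum_cat /pos.
by rewrite opprD addrA subrr add0r.
Qed.

Lemma ht_step s i : `|ht s i.+1 - ht s i| <= 1.
Proof.
rewrite -addn1 htD addrC addKr /ht /pos.
case: (drop i s) => [|[j b] s'] /=; first by rewrite /vsum big_nil mxE normr0.
rewrite take0 /vsum big_cons big_nil addr0 !mxE normrM normrX normrN1 expr1n mul1r.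
by case: (_ && _); rewrite ?normr1 ?normr0.
Qed.

Lemma ht_le s i : ht s i <= i%:Z.
Proof.
elim: i => [|i IH]; first by rewrite ht0.
by have := ht_step s i; rewrite ler_norml => /andP[_]; lia.
Qed.

(** Adjacency of consecutive points is built into the step encoding, so only distinctness remains to
    be required. *)
Definition saw (s : seq step) := forall i j,
  (i <= size s)%N -> (j <= size s)%N -> pos s i = pos s j -> i = j.

Definition half_space (s : seq step) :=
  saw s /\ forall i, (0 < i <= size s)%N -> 0 < ht s i.

Definition bridge (s : seq step) :=
  half_space s /\ forall i, (i <= size s)%N -> ht s i <= ht s (size s).

Lemma saw_take s k : saw s -> saw (take k s).
Proof.
move=> ss i j; rewrite size_take_min !leq_min => /andP[ik isz] /andP[jk jsz].
by rewrite !pos_take //; apply: ss.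
Qed.

Lemma saw_drop s k : saw s -> saw (drop k s).
Proof.
move=> ss i j; rewrite size_drop => isz jsz e.
have : (k + i = k + j)%N; last by lia.
have [ksz|ksz] := leqP k (size s); last by lia.
by apply: ss; [lia|lia|rewrite !posD e].
Qed.

(** The junction point belongs to both pieces, which is why [j] starts at [1]. *)
Lemma saw_cat s1 s2 : saw s1 -> saw s2 ->
  (forall i j, (i <= size s1)%N -> (0 < j <= size s2)%N ->
     pos s1 i <> vsum s1 + pos s2 j) ->
  saw (s1 ++ s2).
Proof.
move=> ss1 ss2 ne i j; rewrite size_cat => isz jsz.
have [i1|i1] := leqP i (size s1); have [j1|j1] := leqP j (size s1).
- by rewrite !pos_catl //; apply: ss1.
- rewrite -(subnKC (ltnW j1)) pos_catr pos_catl // => /ne[//|]; lia.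
- rewrite -(subnKC (ltnW i1)) pos_catr pos_catl // => /esym /ne[//|]; lia.
rewrite -(subnKC (ltnW i1)) -(subnKC (ltnW j1)) !pos_catr => /addrI e.
by congr (_ + _)%N; apply: ss2 e; lia.
Qed.

(** The first bridge never exceeds its final height and the second stays strictly above that height
    once it has started, so they cannot meet. *)
Lemma bridge_cat a b : bridge a -> bridge b -> bridge (a ++ b).
Proof.
move=> [[sa ha] ba] [[sb hb] bb].
have hcat i : ht (a ++ b) (size a + i) = ht a (size a) + ht b i.
  by rewrite /ht pos_catr mxE pos_size.
have hcatl i : (i <= size a)%N -> ht (a ++ b) i = ht a i.
  by move=> ia; rewrite /ht pos_catl.
have a0 : 0 <= ht a (size a) by rewrite -(ht0 a); apply: ba.
have hb0 i : (i <= size b)%N -> 0 <= ht b i.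
  by case: i => [|i] ib; rewrite ?ht0 // ltW // hb.
split; first split.
- apply: saw_cat => // i j ia jb e.
  have : ht a i = ht a (size a) + ht b j by rewrite /ht pos_size e mxE.
  by have := ba i ia; have := hb j jb; lia.
- move=> i; rewrite size_cat => /andP[i0 isz].
  have [ia|ia] := leqP i (size a); first by rewrite hcatl // ha ?i0.
  rewrite -(subnKC (ltnW ia)) hcat; have := hb (i - size a)%N; lia.
move=> i; rewrite size_cat hcat => isz.
have [ia|ia] := leqP i (size a).
  by rewrite hcatl //; have := ba i ia; have := hb0 _ (leqnn _); lia.
rewrite -(subnKC (ltnW ia)) hcat lerD2l; apply: bb; lia.
Qed.

(** Straight walks provide a bridge of every length, which makes all counts at least [1]. *)
Lemma bridge_nseq_up n : bridge (nseq n up).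
Proof.
have htup i : (i <= n)%N -> ht (nseq n up) i = i%:Z.
  move=> il; rewrite /ht /pos take_nseq // /vsum summxE big_nseq.
  by rewrite iter_addr_0 !mxE eqxx mul1r natz.
split; first split.
- move=> i j; rewrite size_nseq => il jl e.
  have : ht (nseq n up) i = ht (nseq n up) j by rewrite /ht e.
  by rewrite !htup //; lia.
- by move=> i; rewrite size_nseq => /andP[i0 il]; rewrite htup // ltz_nat.
- by move=> i; rewrite size_nseq => il; rewrite !htup // lez_nat.
Qed.

Lemma saw_flip s : saw s -> saw (map flip s).
Proof.
move=> ss i j; rewrite size_map => isz jsz; rewrite !pos_flip.
by move=> /(can_inj mirK); apply: ss.
Qed.

Lemma saw_rev s : saw s -> saw (rev (map opps s)).
Proof.
move=> ss i j; rewrite size_rev size_map => isz jsz; rewrite !pos_rev //.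
by move=> /addIr/ss; lia.
Qed.

(** * Unfolding a half-space walk at its last maximum *)

Definition is_peak (s : seq step) (k : nat) := (k <= size s)%N /\
  forall i, (i <= size s)%N -> ht s i <= ht s k /\ ((k < i)%N -> ht s i < ht s k).

Lemma exists_last_max (f : nat -> int) n : exists k, (k <= n)%N /\
  forall i, (i <= n)%N -> f i <= f k /\ ((k < i)%N -> f i < f k).
Proof.
elim: n => [|n [k [kn kP]]].
  by exists 0%N; split=> // i; rewrite leqn0 => /eqP->; split.
have [lt|ge] := ltP (f n.+1) (f k).
  exists k; split=> [|i]; first exact: leqW.
  rewrite leq_eqVlt => /orP[/eqP->|/kP//]; split=> //; exact: ltW.
exists n.+1; split=> // i; rewrite leq_eqVlt => /orP[/eqP->|ilt].
  by split=> //; rewrite ltnn.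
by split; [apply: le_trans ge; have [] := kP i ilt | lia].
Qed.

(** By [peakP] the default [0] of [xget] is never taken for want of a peak. *)
Definition peak (s : seq step) : nat := xget 0%N [set k | is_peak s k].

Lemma peakP s : is_peak s (peak s).
Proof.
have [k kP] := exists_last_max (ht s) (size s).
by have /(xgetPex 0%N) : [set k | is_peak s k] !=set0 by exists k.
Qed.

Definition top (s : seq step) : int := ht s (peak s).

Lemma top_ge s i : (i <= size s)%N -> ht s i <= top s.
Proof. by have [_ h] := peakP s => /h[]. Qed.

Lemma top_ge0 s : 0 <= top s.
Proof. by rewrite -(ht0 s) top_ge. Qed.

Lemma top_le s : top s <= (size s)%:Z.
Proof.
by apply: le_trans (ht_le _ _) _; have [h _] := peakP s; rewrite lez_nat.
Qed.

(** Bounds the drop below the maximum after its last visit. A half-space walk of descent [0] ends at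
    its maximal height, hence is a bridge. *)
Definition descent_le (m : nat) (s : seq step) := forall i,
  (peak s <= i <= size s)%N -> top s - m%:Z <= ht s i.

Definition reflect_after (k : nat) (s : seq step) :=
  take k s ++ map flip (drop k s).

Lemma reflect_afterK k s : reflect_after k (reflect_after k s) = s.
Proof.
rewrite /reflect_after.
have [ks|ks] := leqP k (size s).
  rewrite take_size_cat ?size_takel // drop_size_cat ?size_takel //.
  rewrite mapK ?cat_take_drop //.
  exact: flipK.
rewrite (take_oversize (ltnW ks)) (drop_oversize (ltnW ks)) cats0.
by rewrite (take_oversize (ltnW ks)) (drop_oversize (ltnW ks)) cats0.
Qed.

Lemma size_reflect_after k s : size (reflect_after k s) = size s.
Proof. by rewrite size_cat size_map -size_cat cat_take_drop. Qed.

Lemma ht_reflectl k s i : (i <= k)%N -> (k <= size s)%N ->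
  ht (reflect_after k s) i = ht s i.
Proof.
by move=> ik ks; rewrite /ht pos_catl ?pos_take // size_takel.
Qed.

Lemma ht_reflectr k s i : (k <= i)%N -> (k <= size s)%N ->
  ht (reflect_after k s) i = ht s k *+ 2 - ht s i.
Proof.
move=> ki ks; rewrite -(subnKC ki) htD ht_reflectl // drop_size_cat ?size_takel //.
by rewrite ht_flip htD; lia.
Qed.

(** The tail, reflected in the peak level, lies strictly above that level while the head lies weakly
    below it, so the two parts cannot meet. *)
Lemma half_reflect s : half_space s -> half_space (reflect_after (peak s) s).
Proof.
move=> [ss hs]; have [ks kP] := peakP s; set k := peak s in ks kP *.
have hr i : (i <= size s)%N -> (k < i)%N -> ht s k < ht (reflect_after k s) i.
  by move=> isz ki; rewrite ht_reflectr 1?ltnW //; have [_ /(_ ki)] := kP i isz; lia.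
split.
  apply: saw_cat; [exact: saw_take|exact/saw_flip/saw_drop|].
  move=> i j; rewrite size_takel // size_map size_drop => ik jsz.
  have := hr (k + j)%N; rewrite /ht posD drop_size_cat ?size_takel //.
  rewrite pos_catl ?size_takel // pos_take // => /(_ _ _)/[swap] e.
  have vt : vsum (take k s) = pos s k by [].
  rewrite -vt -e pos_take //; have [le _] := kP i (leq_trans ik ks).
  by rewrite /ht in le; rewrite vt => /(_ _ _); lia.
move=> i; rewrite size_reflect_after => /andP[i0 isz].
have [ik|ki] := leqP i k; first by rewrite ht_reflectl // hs ?i0.
by apply: le_lt_trans (hr _ isz ki); rewrite -(ht0 s); have [] := kP 0%N.
Qed.

Section ReflectPeak.
Variables (m : nat) (s : seq step).
Hypotheses (dm1 : descent_le m.+1 s) (dm : ~ descent_le m s).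
Let k := peak s.
Let s' := reflect_after k s.

Lemma ht_reflect_after_peak i : (k < i <= size s)%N ->
  top s < ht s' i <= top s + m.+1%:Z.
Proof.
move=> /andP[ki isz]; have [ks kP] := peakP s.
rewrite (ht_reflectr _ _ _ (ltnW ki) ks) -/k; have [_ /(_ ki) lt] := kP i isz.
have := dm1 i; rewrite -/k (ltnW ki) isz /top -/k => /(_ isT) ge.
by rewrite -/k in lt; lia.
Qed.

Lemma ht_reflect_before_peak i : (i <= k)%N -> ht s' i <= top s.
Proof.
move=> ik; have [ks kP] := peakP s; rewrite ht_reflectl //; apply: top_ge.
exact: leq_trans ks.
Qed.

(** The greatest drop after the peak is exactly [m.+1], and the reflection turns it into the
    greatest rise. *)
Lemma top_reflect : top s' = top s + m.+1%:Z.
Proof.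
have [ks _] := peakP s; have [ks' kP'] := peakP s'.
(* Failure of [descent_le m] yields a time [j] whose drop exceeds [m]; by [dm1] this drop is
   [m.+1]. *)
have [j /andP[kj jsz] jlt] : exists2 j, (k <= j <= size s)%N & ht s j < top s - m%:Z.
  apply: contra_notP dm => h i ik; rewrite leNgt; apply/negP => lt.
  by apply: h; exists i.
apply/eqP; rewrite eq_le; apply/andP; split.
  have [le|lt] := leqP (peak s') k.
    by have := ht_reflect_before_peak _ le; rewrite /top; lia.
  have /ht_reflect_after_peak : (k < peak s' <= size s)%N.
    by rewrite lt -(size_reflect_after k s).
  by case/andP.
have -> : top s + m.+1%:Z = ht s' j.
  rewrite ht_reflectr // -/k; have := dm1 j; rewrite kj jsz => /(_ isT).
  by move: jlt; rewrite /top -/k; lia.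
by apply: top_ge; rewrite size_reflect_after.
Qed.

(** The new maximum comes after the old peak, where all reflected heights are integers above
    [top s], hence at most [m] below the new maximum [top s + m.+1]. *)
Lemma descent_reflect : descent_le m s'.
Proof.
have [ks' _] := peakP s'.
move=> i /andP[pi isz]; rewrite top_reflect.
have lt : (k < peak s')%N.
  rewrite ltnNge; apply/negP => /ht_reflect_before_peak.
  by rewrite -/(top s') top_reflect; lia.
have /ht_reflect_after_peak : (k < i <= size s)%N.
  by rewrite (leq_trans lt pi) -(size_reflect_after k s).
by lia.
Qed.

End ReflectPeak.

(* The two peaks have the same height, and a reflected walk stays above this
   height after its own peak, so the peaks occur at the same time. *)
Lemma reflect_peak_inj m s1 s2 :
  descent_le m.+1 s1 -> ~ descent_le m s1 ->
  descent_le m.+1 s2 -> ~ descent_le m s2 ->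
  reflect_after (peak s1) s1 = reflect_after (peak s2) s2 -> s1 = s2.
Proof.
move=> a1 b1 a2 b2 e.
have et : top s1 = top s2.
  by have := top_reflect _ _ a1 b1; rewrite e (top_reflect _ _ a2 b2); lia.
have esz : size s1 = size s2.
  by rewrite -(size_reflect_after (peak s1)) e size_reflect_after.
have [p1 _] := peakP s1; have [p2 _] := peakP s2.
have ek : peak s1 = peak s2.
  case: (ltngtP (peak s1) (peak s2)) => // lt.
    have := ht_reflect_after_peak _ _ a1 (peak s2); rewrite lt esz p2 => /(_ isT).
    by rewrite e ht_reflectl // -/(top s2); lia.
  have := ht_reflect_after_peak _ _ a2 (peak s1); rewrite lt -esz p1 => /(_ isT).
  by rewrite -e ht_reflectl // -/(top s1); lia.
by rewrite -(reflect_afterK (peak s1) s1) e ek reflect_afterK.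
Qed.

End Walks.

(** * Counting walks, half-space walks and bridges *)

Section Counting.
Variable d : nat.
Implicit Types (P : seq (step d) -> Prop) (s : seq (step d)).

Definition seqs (n : nat) : seq (seq (step d)) :=
  [seq val t | t <- enum {: n.-tuple (step d)}].

Lemma seqs_uniq n : uniq (seqs n).
Proof. by rewrite map_inj_uniq ?enum_uniq //; apply: val_inj. Qed.

Lemma mem_seqs n s : (s \in seqs n) = (size s == n).
Proof.
apply/mapP/eqP => [[t _ ->]|sz]; first by rewrite size_tuple.
by exists (Tuple (introT eqP sz)); rewrite ?mem_enum.
Qed.

Definition cnt (n : nat) P : nat := \sum_(s <- seqs n | `[< P s >]) 1.

Section Weighted.
Variable R : realFieldType.

Lemma cntE n P : (cnt n P)%:R = \sum_(s <- seqs n | `[< P s >]) 1 :> R.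
Proof. by rewrite /cnt natr_sum. Qed.

(** A sum over pairs makes [ler_sum_inj] applicable to maps that cut or glue walks. *)
Lemma cnt_prod m n P1 P2 : (cnt m P1)%:R * (cnt n P2)%:R =
  \sum_(p <- [seq (a, b) | a <- seqs m, b <- seqs n]
     | `[< P1 p.1 >] && `[< P2 p.2 >]) 1 :> R.
Proof.
rewrite !cntE mulr_suml big_mkcond [RHS]big_mkcond big_allpairs_dep /=.
apply: eq_bigr => a _; case: ifP => Pa; last by rewrite big1.
by rewrite mul1r big_mkcond; apply: eq_bigr.
Qed.

(* The part before the last minimum is reversed and prefixed by an upward step,
   which makes it leave its starting height for good. *)
Lemma saw_half_split n : (cnt n (@saw d))%:R <=
  \sum_(m < n.+1) (cnt m.+1 (@half_space d))%:R * (cnt (n - m) (@half_space d))%:R :> R.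
Proof.
pose lastmin s m := forall i, (i <= size s)%N ->
  ht _ s m <= ht _ s i /\ ((m < i)%N -> ht _ s m < ht _ s i).
(* Each walk has a last minimum, so inserting the sum over its possible times [m] does not lower the
   count. *)
rewrite cntE; apply: (@le_trans _ _ (\sum_(s <- seqs n | `[< saw _ s >])
  \sum_(m < n.+1 | `[< lastmin s m >]) 1)).
  rewrite big_seq_cond [X in _ <= X]big_seq_cond; apply: ler_sum => s.
  rewrite mem_seqs => /andP[/eqP sz _].
  have [k [kn kP]] := exists_last_max (fun i => - ht _ s i) (size s).
  rewrite sz -ltnS in kn.
  rewrite (bigD1 (Ordinal kn)) /= ?lerDl ?sumr_ge0 //.
  by apply/asboolP => i /kP; rewrite lerN2 ltrN2.
rewrite (exchange_big_dep predT) //=; apply: ler_sum => m _.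
rewrite cnt_prod.
apply: (@ler_sum_inj R _ _ _ _ _ _
  (fun s => (up d :: rev (map (@opps d) (take m s)), drop m s))) => //.
- exact: seqs_uniq.
- move=> s1 s2 _ _ [] /(can_inj (@revK _)) /(inj_map (can_inj (@oppsK d))) e1 e2.
  by rewrite -(cat_take_drop m s1) e1 e2 cat_take_drop.
move=> s; rewrite mem_seqs => /eqP sz /andP[/asboolP ss /asboolP sm].
have ms : (m <= size s)%N by rewrite sz -ltnS.
split=> //.
  apply/allpairsP; exists (up d :: rev (map (@opps d) (take m s)), drop m s).
  by rewrite !mem_seqs /= size_rev size_map size_takel // size_drop sz !eqxx.
apply/andP; split; apply/asboolP => /=.
  have vup : vsum d [:: up d] 0 ord0 = 1.
    by rewrite /vsum big_seq1 !mxE eqxx /= mulr1.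
  (* Time [m] is a minimum, so the reversed head never goes below its start; after the step [up] it
     therefore stays at height at least [1]. *)
  have hup i : (i <= m)%N -> ht _ (rev [seq opps d i | i <- take m s]) i >= 0.
    move=> im; rewrite /ht pos_rev ?size_takel // pos_take ?leq_subr // !mxE.
    have [+ _] := sm (m - i)%N (leq_trans (leq_subr _ _) ms).
    by rewrite /ht /vsum /pos subr_ge0.
  split.
    rewrite -cat1s; apply: saw_cat.
    - move=> [|[|i]] [|[|j]] //= _ _; rewrite pos0 pos_size => /matrixP/(_ 0 ord0).
        by rewrite vup mxE.
      by rewrite vup mxE.
    - exact/saw_rev/saw_take.
    move=> i j; rewrite size_rev size_map size_takel // => i1 /andP[j0 jm] e.
    move/matrixP/(_ 0 ord0): (e); rewrite mxE vup => e0.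
    have := hup j jm; rewrite /ht.
    case: i i1 e e0 => [|[|//]] _ e e0.
      by move: e0; rewrite pos0 mxE => e0 /(ltr_pwDl ltr01); rewrite -e0 ltxx.
    move: e; rewrite pos_size -[X in X = _]addr0 => /addrI e _.
    have /saw_rev/(_ 0%N j) := saw_take _ _ m ss.
    by rewrite size_rev size_map size_takel // pos0 => /(_ _ jm e); lia.
  move=> [//|i] /=; rewrite size_rev size_map size_takel // ltnS => im.
  rewrite -cat1s -[i.+1]add1n -(_ : size [:: up d] = 1%N) // /ht pos_catr mxE vup.
  exact: ltr_pwDl ltr01 (hup i im).
split; first exact: saw_drop.
move=> i; rewrite size_drop => /andP[i0 isz].
have mi : (m < m + i)%N by lia.
have [|_ /(_ mi)] := sm (m + i)%N; first by lia.
by rewrite htD ltrDl.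
Qed.

Lemma bridge_sub_saw n : (cnt n (@bridge d))%:R <= (cnt n (@saw d))%:R :> R.
Proof.
rewrite !cntE; apply: (@ler_sum_inj R _ _ _ _ _ _ id) => //.
  exact: seqs_uniq.
by move=> s sin /asboolP[[ss _] _]; split=> //; apply/asboolP.
Qed.

Lemma saw_cut m n : (cnt (m + n) (@saw d))%:R <=
  (cnt m (@saw d))%:R * (cnt n (@saw d))%:R :> R.
Proof.
rewrite cnt_prod cntE.
apply: (@ler_sum_inj R _ _ _ _ _ _ (fun s => (take m s, drop m s))) => //.
- exact: seqs_uniq.
- by move=> s1 s2 _ _ [] e1 e2; rewrite -(cat_take_drop m s1) e1 e2 cat_take_drop.
move=> s; rewrite mem_seqs => /eqP sz /asboolP ss; split=> //.
  apply/allpairsP; exists (take m s, drop m s).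
  by rewrite !mem_seqs /= size_takel ?size_drop sz ?leq_addr // addKn !eqxx.
by apply/andP; split; apply/asboolP; [exact: saw_take|exact: saw_drop].
Qed.

Lemma bridge_concat m n : (cnt m (@bridge d))%:R * (cnt n (@bridge d))%:R <=
  (cnt (m + n) (@bridge d))%:R :> R.
Proof.
rewrite cnt_prod cntE.
have memE (p : seq (step d) * seq (step d)) :
    p \in [seq (a, b) | a <- seqs m, b <- seqs n] ->
    size p.1 = m /\ size p.2 = n.
  case/allpairsP => -[a b] /= [+ + ->] /=.
  by rewrite !mem_seqs => /eqP -> /eqP ->.
apply: (@ler_sum_inj R _ _ _ _ _ _ (fun p => p.1 ++ p.2)) => //.
- rewrite allpairs_uniq ?seqs_uniq //.
  by move=> [a b] [a' b'] _ _ [-> ->].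
- move=> [a b] [a' b'] /andP[/memE[/= s1 _] _] /andP[/memE[/= s2 _] _] /eqP.
  by rewrite eqseq_cat ?s1 ?s2 // => /andP[/eqP-> /eqP->].
move=> [a b] /memE[/= s1 s2] /andP[/asboolP ba /asboolP bb].
split=> //; first by rewrite mem_seqs size_cat s1 s2.
by apply/asboolP/bridge_cat.
Qed.

Lemma cnt_bridge_ge1 n : (0 < cnt n (@bridge d))%N.
Proof.
have bup := bridge_nseq_up d n.
rewrite /cnt (big_rem (nseq n (up d))) /= ?mem_seqs ?size_nseq //.
by case: asboolP.
Qed.

Definition half_weight (z : R) (m n : nat) : R :=
  \sum_(s <- seqs n | `[< half_space d s /\ descent_le d m s >]) z ^+ `|top d s|%N.

(** A walk counted on the left either has descent at most [m], or descent exactly [m.+1]. In the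
    second case reflection at the peak is injective and raises the height by [m.+1], which costs the
    factor [z ^- m.+1]. *)
Lemma half_weightS (z : R) m n : 0 < z ->
  half_weight z m.+1 n <= (1 + z ^- m.+1) * half_weight z m n.
Proof.
move=> z0; have zn k : 0 <= z ^+ k by rewrite exprn_ge0 // ltW.
rewrite mulrDl mul1r mulr_sumr.
rewrite /half_weight (bigID (fun s => `[< descent_le d m s >])) /= lerD //.
  apply: (@ler_sum_inj R _ _ _ _ _ _ id) => //; first exact: seqs_uniq.
  move=> s sin /andP[/asboolP[hs _] /asboolP ds]; split=> //.
  by apply/asboolP.
apply: (@ler_sum_inj R _ _ _ _ _ _ (fun s => reflect_after d (peak d s) s)).
- exact: seqs_uniq.
- by move=> s; rewrite mulr_ge0 // invr_ge0.
- move=> s1 s2 /andP[_ /andP[/asboolP[_ a1] /asboolP b1]].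
  move=> /andP[_ /andP[/asboolP[_ a2] /asboolP b2]].
  exact: reflect_peak_inj a1 b1 a2 b2.
move=> s; rewrite mem_seqs => sz /andP[/asboolP[hs a] /asboolP b]; split.
- by rewrite mem_seqs size_reflect_after.
- by apply/asboolP; split; [exact: half_reflect|exact: descent_reflect].
rewrite (top_reflect _ _ _ a b).
have -> : absz (top d s + m.+1%:Z) = (m.+1 + `|top d s|)%N.
  by have := top_ge0 d s; lia.
by rewrite exprD mulKf // expf_neq0 // gt_eqF.
Qed.

(** Walks of descent [0] are bridges, and their height is at most their length [n]. *)
Lemma half_weight0 (z : R) n : 1 <= z ->
  half_weight z 0 n <= z ^+ n * (cnt n (@bridge d))%:R.
Proof.
move=> z1; rewrite cntE mulr_sumr.
apply: (@ler_sum_inj R _ _ _ _ _ _ id) => //; first exact: seqs_uniq.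
  by move=> s; rewrite mulr1 exprn_ge0 // (le_trans ler01).
move=> s sin; move: (sin); rewrite mem_seqs => sz /asboolP[hs ds]; split=> //.
  apply/asboolP; split=> // i isz; have [ps pP] := peakP d s.
  have ds1 := ds (size s); rewrite ps leqnn subr0 in ds1.
  exact: le_trans (top_ge d s i isz) (ds1 isT).
rewrite mulr1 ler_weXn2l //.
by have := top_ge0 d s; have := top_le d s; rewrite (eqP sz); lia.
Qed.

(* Unfolding the last maximum turns a half-space walk of descent [m] into one
   of descent less than [m] whose height is larger by [m], so that the weight
   [z ^+ top] pays [z ^- m] for each admissible value of [m]. *)
Lemma half_le_bridge (z : R) n : 1 <= z -> (cnt n (@half_space d))%:R <=
  z ^+ n * (\prod_(1 <= k < n.+1) (1 + z ^- k)) * (cnt n (@bridge d))%:R.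
Proof.
move=> z1; have z0 : 0 < z by apply: lt_le_trans z1.
have weight m : half_weight z m n <=
    (\prod_(1 <= k < m.+1) (1 + z ^- k)) * (z ^+ n * (cnt n (@bridge d))%:R).
  elim: m => [|m IH]; first by rewrite big_geq // mul1r half_weight0.
  rewrite big_nat_recr //= [X in X * _]mulrC -mulrA.
  apply: (le_trans (half_weightS _ _ _ z0)); rewrite ler_wpM2l //.
  by rewrite addr_ge0 // invr_ge0 exprn_ge0 // ltW.
rewrite [_ ^+ _ * _]mulrC -mulrA; apply: le_trans (weight n).
rewrite cntE; apply: (@ler_sum_inj R _ _ _ _ _ _ id) => //.
- exact: seqs_uniq.
- by move=> s; rewrite exprn_ge0 // ltW.
move=> s sin /asboolP hs; split=> //; last by rewrite exprn_ege1.
move: sin; rewrite mem_seqs => /eqP sz.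
(* Heights lie between [0] and [n], so the descent is at most [n] and no walk is lost in
   [half_weight z n n]. *)
apply/asboolP; split=> // i /andP[_ isz].
have := top_le d s; rewrite sz; case: i isz => [|i] isz; first by rewrite ht0; lia.
by have [_ /(_ i.+1 isz)] := hs; lia.
Qed.

(** In each term of [saw_half_split] both half-space walks unfold into bridges, of lengths [m.+1]
    and [n - m], which glue to one bridge of length [n.+1]. The factor [n.+1] counts the values of
    [m]. *)
Lemma saw_le_bridge (z : R) n : 1 <= z -> (cnt n (@saw d))%:R <=
  n.+1%:R * (z ^+ n.+1 * (\prod_(1 <= k < n.+2) (1 + z ^- k)) ^+ 2)
  * (cnt n.+1 (@bridge d))%:R.
Proof.
move=> z1; have z0 : 0 < z by apply: lt_le_trans z1.
have f1 k : 1 <= 1 + z ^- k by rewrite lerDl invr_ge0 exprn_ge0 // ltW.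
pose F N := \prod_(1 <= k < N.+1) (1 + z ^- k).
have F0 N : 0 <= F N.
  by apply: prodr_ge0 => k _; apply: le_trans (f1 k).
(* All factors are at least [1], so both products may be extended to the common range up to
   [n.+1]. *)
have FS N k : F N <= F (N + k)%N.
  elim: k => [|k IH]; first by rewrite addn0.
  by apply: (le_trans IH); rewrite addnS {2}/F big_nat_recr //= ler_peMr ?f1 //.
apply: (le_trans (saw_half_split n)).
rewrite -mulrA mulr_natl.
have <- (c : R) : \sum_(m < n.+1) c = c *+ n.+1 by rewrite sumr_const card_ord.
apply: ler_sum => m _.
have h1 := half_le_bridge _ m.+1 z1; have h2 := half_le_bridge _ (n - m) z1.
apply: (le_trans (ler_pM _ _ h1 h2)) => //.
have -> : forall a b c d e f : R,
    a * b * c * (d * e * f) = (a * d) * (b * e) * (c * f) by move=> *; ring.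
rewrite -exprD; have mn : (m.+1 + (n - m) = n.+1)%N by have := ltn_ord m; lia.
rewrite mn; apply: ler_pM => //.
- by rewrite mulr_ge0 ?exprn_ge0 ?mulr_ge0 ?F0 // ltW.
- rewrite ler_pM2l ?exprn_gt0 // expr2; apply: ler_pM; rewrite ?F0 //.
    by rewrite -[n.+2](_ : (m.+1 + (n - m)).+1 = _) ?FS // mn.
  by rewrite -[n.+2](_ : ((n - m) + m.+1).+1 = _) ?FS // addnC mn.
by have := bridge_concat m.+1 (n - m); rewrite mn.
Qed.

End Weighted.
End Counting.

(** * Step sequences and the walks of the statement *)

Section Counts.
Variable d : nat.

Lemma stepv_inj : injective (@stepv d).
Proof.
move=> [i b] [j c] /matrixP/(_ 0 i); rewrite !mxE /= eqxx /= mulr1.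
have [ij|ij] := eqVneq i j; last first.
  by rewrite mulr0 => /eqP; rewrite signr_eq0.
by rewrite mulr1 ij; case: b; case: c => //; rewrite ?expr0 ?expr1.
Qed.

Lemma l1norm_stepv e : l1norm (stepv d e) = 1.
Proof.
case: e => j b; rewrite /l1norm (bigD1 j) //= big1 => [|i ij].
  by rewrite !mxE /= eqxx mulr1 addr0 normrX normrN1 expr1n.
by rewrite !mxE /= (negPf ij) mulr0 normr0.
Qed.

(** A nonzero integer entry already uses up the whole norm, so the other entries vanish; the Boolean
    records its sign. *)
Lemma l1norm_eq1 v : l1norm v = 1 -> exists e, v = stepv d e.
Proof.
move=> v1; have [i vi0] : exists i, v 0 i != 0.
  have [//|nv] := pselect (exists i, v 0 i != 0); move: v1.
  rewrite /l1norm big1 // => i _; apply/eqP; rewrite normr_eq0.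
  by apply: contra_notT nv => vi; exists i.
move: v1; rewrite /l1norm (bigD1 i) //= => v1.
have vi1 : 1 <= `|v 0 i| by rewrite -gtz0_ge1 normr_gt0.
have rest0 : \sum_(j < d.+1 | j != i) `|v 0 j| = 0.
  by apply/eqP; rewrite eq_le sumr_ge0 // andbT -(lerD2l `|v 0 i|) v1 addr0.
exists (i, v 0 i < 0); apply/rowP => j; rewrite !mxE /=.
have [->|ji] := eqVneq j i.
  move: v1; rewrite rest0 addr0 mulr1; case: ltrgt0P vi0 => // vi _ e.
  by rewrite expr1 -e opprK.
rewrite mulr0; apply/eqP; rewrite -normr_eq0.
move: rest0 => /eqP; rewrite psumr_eq0 // => /allP/(_ j).
by rewrite mem_index_enum ji => /(_ isT).
Qed.

Lemma posS s k : (k < size s)%N ->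
  pos d s k.+1 = pos d s k + stepv d (nth (up d) s k).
Proof.
by move=> ks; rewrite /pos (take_nth (up d)) // -cats1 vsum_cat {2}/vsum big_seq1.
Qed.

Definition walk_of n (t : n.-tuple (step d)) : {ffun 'I_n.+1 -> 'rV[int]_d.+1} :=
  [ffun k : 'I_n.+1 => pos d t k].

Arguments walk_of {n} t.

Lemma walk_ofE n (t : n.-tuple (step d)) k : walk_of t k = pos d t k.
Proof. by rewrite ffunE. Qed.

Lemma walk_of_inj n : injective (@walk_of n).
Proof.
move=> t u /ffunP e; apply/val_inj/(@eq_from_nth _ (up d)); rewrite !size_tuple //.
move=> k kn; apply: stepv_inj.
have pe j : (j < n.+1)%N -> pos d t j = pos d u j.
  by move=> jn; have := e (Ordinal jn); rewrite !walk_ofE.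
have := pe k.+1 kn; rewrite !posS ?size_tuple // pe; last by rewrite ltnW.
exact: addrI.
Qed.

Lemma walk_of_surj n (w : {ffun 'I_n.+1 -> 'rV[int]_d.+1}) :
  (forall i j : 'I_n.+1, j = i.+1 :> nat -> l1norm (w j - w i) = 1) ->
  w ord0 = 0 -> exists t, w = walk_of t.
Proof.
move=> ws w0.
(* The step at time [k] is picked from the set [S k], which [l1norm_eq1] shows to be nonempty. *)
pose S (k : 'I_n) : set (step d) := [set e | w (inord k.+1) - w (inord k) = stepv d e].
pose e (k : 'I_n) := xget (up d) (S k).
have eP (k : 'I_n) : w (inord k.+1) - w (inord k) = stepv d (e k).
  have [u uS] : exists u, S k u.
    have kn := ltn_ord k; apply: l1norm_eq1; apply: ws.
    by rewrite !inordK // ltnS ltnW.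
  exact: (xgetI (up d) uS).
pose t := [tuple e k | k < n].
have wt k : (k < n.+1)%N -> w (inord k) = pos d t k.
  elim: k => [|k IH] kn.
    by rewrite pos0 -w0; congr (w _); apply/val_inj; rewrite /= inordK.
  rewrite posS ?size_tuple // -IH; last by rewrite ltnW.
  have -> : nth (up d) t k = e (Ordinal (kn : (k < n)%N)).
    by rewrite -[k in LHS]/(val (Ordinal (kn : (k < n)%N))) -tnth_nth tnth_mktuple.
  by rewrite -eP addrC subrK.
by exists t; apply/ffunP => k; rewrite walk_ofE -wt ?inord_val.
Qed.

Lemma card_walks n (A : set {ffun 'I_n.+1 -> 'rV[int]_d.+1}) P :
  finite_set A -> A = @walk_of n @` [set t | P (val t)] ->
  #|` fset_set A| = cnt d n P.
Proof.
move=> finA eA.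
have -> : cnt d n P = size
    [seq walk_of t | t <- enum {: n.-tuple (step d)} & `[< P (val t) >]].
  by rewrite size_map size_filter /cnt sum1_count /seqs count_map.
apply/perm_size/uniq_perm; first exact: fset_uniq.
  by rewrite (map_inj_uniq (@walk_of_inj n)) filter_uniq ?enum_uniq.
move=> w; apply/idP/mapP.
  rewrite in_fset_set // inE eA => -[t Pt <-]; exists t => //.
  by rewrite mem_filter mem_enum andbT; apply/asboolP.
move=> [t]; rewrite mem_filter => /andP[/asboolP Pt _] ->.
by rewrite in_fset_set // inE eA; exists t.
Qed.

Lemma is_saw_walk_of n (t : n.-tuple (step d)) : is_saw (walk_of t) <-> saw d t.
Proof.
split=> [[inj _] i j|st].
  rewrite size_tuple -ltnS => il; rewrite -ltnS => jl e.
  by have := inj (Ordinal il) (Ordinal jl); rewrite !walk_ofE => /(_ e) [].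
split=> [i j|i j ji].
  rewrite !walk_ofE => e; apply/val_inj/st => //;
    rewrite size_tuple -ltnS; exact: ltn_ord.
rewrite !walk_ofE ji posS; last by rewrite size_tuple -ltnS -ji.
by rewrite addrC addKr l1norm_stepv.
Qed.

Lemma is_bridge_walk_of n (t : n.-tuple (step d)) :
  is_bridge (walk_of t) <-> bridge d t.
Proof.
split=> [[/is_saw_walk_of st bt]|[[st ht0] bt]].
  split; first split=> // i; rewrite size_tuple.
    move=> /andP[i0 il]; have [] := bt (@Ordinal n.+1 i il) i0.
    by rewrite /first_coord !walk_ofE /= pos0 mxE.
  move=> [|i] il; last first.
    by have [_] := bt (@Ordinal n.+1 i.+1 il) isT; rewrite /first_coord !walk_ofE.
  (* At time [0] the bridge condition says nothing directly; the final height is compared with the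
     start through time [1]. *)
  case: n t st bt {il} => [|n'] t' st bt; first by rewrite ht0.
  have [lt le] := bt (@Ordinal n'.+2 1 isT) isT.
  by move: (lt_le_trans lt le); rewrite /first_coord !walk_ofE /= => /ltW.
split=> [|i i0]; first exact/is_saw_walk_of.
have il : (i <= size t)%N by rewrite size_tuple -ltnS.
rewrite /first_coord !walk_ofE /= pos0 mxE; split.
  by apply: ht0; rewrite i0.
by have := bt i il; rewrite size_tuple.
Qed.

Lemma saw_countE n : saw_count d.+1 n = cnt d n (@saw d).
Proof.
apply: card_walks; first exact: finite_saws.
apply/seteqP; split=> [w [sw w0]|_ [t st <-]].
  have [t et] := walk_of_surj _ _ sw.2 w0.
  by exists t => //=; apply/is_saw_walk_of; rewrite -et.
by split; [exact/is_saw_walk_of|rewrite walk_ofE pos0].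
Qed.

Lemma bridge_countE n : bridge_count d.+1 n.+1 = cnt d n.+1 (@bridge d).
Proof.
apply: card_walks; first exact: finite_bridges.
apply/seteqP; split=> [w [sw w0]|_ [t st <-]].
  have [t et] := walk_of_surj _ _ sw.1.2 w0.
  by exists t => //=; apply/is_bridge_walk_of; rewrite -et.
by split; [exact/is_bridge_walk_of|rewrite walk_ofE pos0].
Qed.

End Counts.

(** * The partition product *)

Section Basel.
Variable R : realType.
Implicit Types x t : R.

Lemma MVT_closed (f df : R -> R) a b : a < b ->
  (forall x, a <= x <= b -> is_derive x 1 f (df x)) ->
  exists2 c, a < c < b & f b - f a = df c * (b - a).
Proof.
move=> ab fd; have [x|| c] := @MVT R f df a b ab.
- by rewrite in_itv /= => /andP[ax xb]; apply: fd; rewrite !ltW.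
- apply: derivable_within_continuous => x.
  by rewrite in_itv /= => /fd[].
by rewrite in_itv /= => cab e; exists c.
Qed.

Lemma sin_le_id x : 0 <= x -> sin x <= x.
Proof.
rewrite le_eqVlt => /orP[/eqP<-|x0]; first by rewrite sin0.
have [c _] := @MVT_closed sin cos 0 x x0 (fun y _ => is_derive_sin y).
by rewrite sin0 !subr0 => ->; rewrite ler_piMl ?cos_le1 // ltW.
Qed.

Lemma sinh_ge_id x : 0 <= x -> 2 * x <= expR x - expR (- x).
Proof.
rewrite le_eqVlt => /orP[/eqP<-|x0]; first by rewrite oppr0 subrr mulr0.
pose g (y : R) := expR y - expR (- y); pose dg (y : R) := expR y + expR (- y).
have [|c _] := @MVT_closed g dg 0 x x0.
  move=> y _; apply: is_derive_eq.
  by rewrite mulrN1 opprK.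
rewrite /g subr0 oppr0 subrr subr0 => ->; rewrite ler_pM2r // /dg.
have := lerD (expR_ge1Dx c) (expR_ge1Dx (- c)); lra.
Qed.

Definition csc2 x := (sin x ^+ 2)^-1.

(** This is [1 / s ^+ 2 + 1 / c ^+ 2 = 1 / (s * c) ^+ 2] for the sine and cosine of [x / 2], with
    [sin x = 2 * s * c]. *)
Lemma csc2_halving x : 0 < x < pi -> csc2 (x / 2) + csc2 (x / 2 + pi / 2) = 4 * csc2 x.
Proof.
move=> /andP[x0 xpi].
have s0 : sin (x / 2) != 0.
  by rewrite gt_eqF // sin_gt0_pihalf //; apply/andP; split; lra.
have c0 : cos (x / 2) != 0.
  by rewrite gt_eqF // cos_gt0_pihalf //; apply/andP; split; lra.
rewrite /csc2 sinDpihalf [in sin x](_ : x = (x / 2) *+ 2); last first.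
  by rewrite -mulr_natr divfK.
rewrite sin_mulr2n; have := cos2Dsin2 (x / 2) => e.
have -> : (sin (x / 2) ^+ 2)^-1 + (cos (x / 2) ^+ 2)^-1
    = (cos (x / 2) ^+ 2 + sin (x / 2) ^+ 2) / (sin (x / 2) * cos (x / 2)) ^+ 2.
  by field; apply/andP.
by rewrite e; field; apply/andP.
Qed.

Lemma csc2_reflect x : csc2 (pi - x) = csc2 x.
Proof. by rewrite /csc2 sinB sinpi cospi mul0r sub0r mulN1r opprK. Qed.

Lemma sum_split_middle (F : nat -> R) m : (0 < m)%N ->
  \sum_(1 <= k < m + m) F k =
  \sum_(1 <= k < m) F k + F m + \sum_(1 <= k < m) F (k + m)%N.
Proof.
move=> m0; rewrite (big_cat_nat (n := m)) //= ?leq_addr //.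
rewrite [X in _ + X]big_ltn; last by rewrite -addn1 leq_add2l.
by rewrite -[m.+1]add1n big_addn addnK addrA.
Qed.

(** Passing from [n] to [n.+1], [csc2_halving] pairs [k] with [k + 2 ^ n], and the unpaired middle
    term is [1]: the sum [S] becomes [4 * S + 1]. *)
Lemma sum_csc2 n :
  \sum_(1 <= k < 2 ^ n) csc2 (k%:R * pi / (2 ^ n)%:R) = (4 ^+ n - 1) / 3.
Proof.
elim: n => [|n IH]; first by rewrite big_geq // expr0 subrr mul0r.
have N0 : (0 < 2 ^ n)%N by rewrite expn_gt0.
have R0 : (2 ^ n)%:R != 0 :> R by rewrite pnatr_eq0 -lt0n.
have RR0 : (2 ^ n)%:R + (2 ^ n)%:R != 0 :> R by rewrite -mulr2n mulrn_eq0.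
rewrite expnS mul2n -addnn sum_split_middle // addrAC -big_split /= natrD.
have -> : csc2 ((2 ^ n)%:R * pi / ((2 ^ n)%:R + (2 ^ n)%:R)) = 1.
  rewrite (_ : _ / _ = pi / 2); last by field; rewrite ?R0 ?RR0.
  by rewrite /csc2 sin_pihalf expr1n invr1.
rewrite (eq_big_nat _ _ (F2 := fun k => 4 * csc2 (k%:R * pi / (2 ^ n)%:R))).
  by rewrite -mulr_sumr IH exprS; field.
move=> k /andP[k0 kn]; rewrite -csc2_halving.
  by rewrite natrD; congr (csc2 _ + csc2 _); field; rewrite ?R0 ?RR0.
have Rp : 0 < (2 ^ n)%:R :> R by rewrite ltr0n.
rewrite divr_gt0 ?mulr_gt0 ?pi_gt0 ?ltr0n //=.
by rewrite ltr_pdivrMr // mulrC ltr_pM2l ?pi_gt0 // ltr_nat.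
Qed.

(** The symmetry [csc2_reflect] makes both halves of the full sum equal; the nonnegative middle term
    is dropped. *)
Lemma sum_csc2_half n :
  \sum_(1 <= k < 2 ^ n) csc2 (k%:R * pi / (2 ^ n.+1)%:R) <= 4 ^+ n.+1 / 6.
Proof.
have N0 : (0 < 2 ^ n)%N by rewrite expn_gt0.
have R0 : (2 ^ n)%:R != 0 :> R by rewrite pnatr_eq0 -lt0n.
have RR0 : (2 ^ n)%:R + (2 ^ n)%:R != 0 :> R by rewrite -mulr2n mulrn_eq0.
have := sum_csc2 n.+1; rewrite expnS mul2n -addnn sum_split_middle // natrD.
set M := (2 ^ n)%:R; set S := (X in X + _ + _ = _); set T := (X in _ + _ + X = _).
have -> : T = S.
  rewrite /T /S big_nat_rev /=; apply: eq_big_nat => k /andP[k0 kn].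
  rewrite -[RHS]csc2_reflect; congr csc2.
  rewrite (_ : 1 + 2 ^ n - k.+1 + 2 ^ n = 2 ^ n + 2 ^ n - k)%N; last by lia.
  rewrite natrB ?natrD -/M; last by lia.
  by field; rewrite ?R0 ?RR0.
have c0 : 0 <= csc2 (M * pi / (M + M)) by rewrite invr_ge0 sqr_ge0.
have : 0 < (4 : R) ^+ n.+1 by rewrite exprn_gt0.
by rewrite -/S; set u := 4 ^+ n.+1; move=> u0 e; lra.
Qed.

(** For [y = k * pi / 2 ^ n.+2] the inequality [sin y <= y] bounds [1 / y ^+ 2] by [csc2 y], and
    [sum_csc2_half] sums these bounds. *)
Lemma sum_inv_sqr_le n : \sum_(1 <= j < n.+1) (j%:R ^+ 2)^-1 <= pi ^+ 2 / 6 :> R.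
Proof.
have p0 := pi_gt0 R.
apply: (@le_trans _ _ (\sum_(1 <= j < 2 ^ n.+1) (j%:R ^+ 2)^-1)).
  rewrite [X in _ <= X](big_cat_nat (n := n.+1)) //=; last first.
    by apply: ltnW; apply: ltn_expl.
  by rewrite lerDl; apply: sumr_ge0 => j _; rewrite invr_ge0 sqr_ge0.
have u0 : 0 < (4 : R) ^+ n.+2 by rewrite exprn_gt0.
rewrite -(ler_pM2l u0) mulr_sumr.
have h := sum_csc2_half n.+1; rewrite -(ler_pM2l (exprn_gt0 2 p0)) in h.
rewrite [X in _ <= X](_ : _ = pi ^+ 2 * (4 ^+ n.+2 / 6)); last exact: mulrCA.
apply: le_trans h; rewrite mulr_sumr; apply: ler_sum_nat => k /andP[k0 kn].
have Q0 : 0 < (2 ^ n.+2)%:R :> R by rewrite ltr0n expn_gt0.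
have q4 : 4 ^+ n.+2 = (2 ^ n.+2)%:R ^+ 2 :> R.
  by rewrite natrX -exprM mulnC exprM (_ : 2 ^+ 2 = 4 :> R) //; ring.
have k0R : 0 < k%:R :> R by rewrite ltr0n.
set y := k%:R * pi / (2 ^ n.+2)%:R.
have y0 : 0 < y by rewrite divr_gt0 // mulr_gt0.
have sy : 0 < sin y.
  apply: sin_gt0_pi; rewrite y0 /y ltr_pdivrMr // mulrC ltr_pM2l // ltr_nat.
  by rewrite (ltn_trans kn) // ltn_exp2l.
have -> : 4 ^+ n.+2 * (k%:R ^+ 2)^-1 = pi ^+ 2 * (y ^+ 2)^-1.
  rewrite q4 {sy y0}/y; move: (pi) p0 => p p0.
  by field; rewrite !gt_eqF.
rewrite ler_pM2l ?exprn_gt0 // /csc2 lef_pV2 ?posrE ?exprn_gt0 //.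
by rewrite lerXn2r ?nnegrE ?sin_le_id // ltW.
Qed.

End Basel.

(** * Euler's identity and the bound on the product *)

Section PartitionProduct.
Variable R : realType.
Implicit Types x y t : R.

(* Multiplied by [\prod_(k <= N) (1 - x ^+ k)], the left-hand side becomes
   [\prod_(k <= 2 N) (1 - x ^+ k)]. *)
Lemma euler_prod_le1 x N : 0 < x < 1 ->
  \prod_(1 <= k < N.+1) (1 + x ^+ k) * \prod_(k < N) (1 - x ^+ k.*2.+1) <= 1.
Proof.
move=> /andP[x0 x1].
have xk0 k : 0 < x ^+ k by rewrite exprn_gt0.
have f01 k : 0 < 1 - x ^+ k.+1 <= 1.
  by rewrite subr_gt0 gerBl (ltW (xk0 _)) andbT exprn_ilt1 // ltW.
pose G n := \prod_(k < n) (1 - x ^+ k.+1).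
have G0 n : 0 < G n by apply: prodr_gt0 => k _; case/andP: (f01 k).
have Gle n m : G (n + m)%N <= G n.
  elim: m => [|m IH]; first by rewrite addn0.
  rewrite addnS /G big_ord_recr /=; apply: le_trans IH.
  by rewrite ler_piMr ?(ltW (G0 _)) //; case/andP: (f01 (n + m)%N).
suff e : \prod_(1 <= k < N.+1) (1 + x ^+ k) * \prod_(k < N) (1 - x ^+ k.*2.+1) * G N
    = G (N + N)%N.
  by rewrite -(ler_pM2r (G0 N)) e mul1r.
elim: N => [|N IH]; first by rewrite big_geq // /G !big_ord0 !mulr1.
rewrite big_nat_recr //= big_ord_recr /=.
have -> : G N.+1 = G N * (1 - x ^+ N.+1) by rewrite /G big_ord_recr.
(* The last factor is [(1 - x ^+ N.+1) * (1 + x ^+ N.+1)]: one part belongs to [G N.+1], the other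
   to the distinct-parts product. *)
have -> : G (N.+1 + N.+1)%N =
    G (N + N)%N * (1 - x ^+ N.*2.+1) * (1 - x ^+ N.+1 * x ^+ N.+1).
  by rewrite addSn addnS /G !big_ord_recr /= -exprD addSn addnS -addnn.
by rewrite -IH; ring.
Qed.

(** Adding the Taylor polynomial of [- ln (1 - z)] to [ln (1 - z)] leaves the derivative
    [- z ^+ J / (1 - z)], and the mean value theorem bounds the remainder. *)
Lemma ln1B_ge y J : 0 < y < 1 ->
  - ln (1 - y) <= \sum_(1 <= j < J.+1) y ^+ j / j%:R + y ^+ J.+1 / (1 - y).
Proof.
move=> /andP[y0 y1].
pose p : {poly R} := \sum_(j < J) j.+1%:R^-1 *: 'X^(j.+1).
have pE z : p.[z] = \sum_(1 <= j < J.+1) z ^+ j / j%:R.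
  rewrite big_add1 big_mkord horner_sum; apply: eq_bigr => j _.
  by rewrite hornerZ hornerXn mulrC.
have dpE z : p^`().[z] = \sum_(j < J) z ^+ j.
  rewrite /p raddf_sum horner_sum; apply: eq_bigr => j _.
  rewrite /= derivZ derivXn /= hornerZ hornerMn hornerXn.
  by rewrite -[_ ^+ _ *+ _]mulr_natl mulKf ?pnatr_eq0.
pose f (z : R) := ln (1 - z) + p.[z].
pose df (z : R) := - (1 - z)^-1 + p^`().[z].
have [|c /andP[c0 cy]] := @MVT_closed R f df 0 y y0.
  move=> z /andP[z0 zy].
  have z1 : 0 < 1 - z by lra.
  have dln : is_derive z 1 (fun z => ln (1 - z)) (- (1 - z)^-1).
    have dl := is_derive1_ln z1.
    rewrite -mulrN1; apply: is_derive1_comp.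
    apply: is_derive_eq; lra.
  exact: (is_deriveD dln (is_derive_poly p z)).
have c1 : 0 < 1 - c by lra.
have dfc : df c = - (c ^+ J / (1 - c)).
  rewrite /df dpE; have := subrX1 c J => e.
  have -> : \sum_(j < J) c ^+ j = (1 - c ^+ J) / (1 - c).
    by rewrite -[1 - c ^+ J]opprB e; field; rewrite gt_eqF.
  by field; rewrite gt_eqF.
rewrite dfc /f subr0 ln1 pE.
have -> : p.[0] = 0.
  by rewrite pE big_nat big1 // => j /andP[j1 _]; rewrite expr0n gtn_eqF ?mul0r.
rewrite add0r !subr0 => e.
have : c ^+ J / (1 - c) * y <= y ^+ J.+1 / (1 - y).
  rewrite exprS mulrC -mulrA ler_pM2l //; apply: ler_pM.
  - by rewrite exprn_ge0 // ltW.
  - by rewrite invr_ge0 ltW.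
  - by rewrite lerXn2r ?nnegrE // ltW.
  by rewrite lef_pV2 ?posrE //; lra.
by lra.
Qed.

(** The full geometric series sums to [q / (1 - q ^+ 2) = (q^-1 - q)^-1], the inverse of twice the
    hyperbolic sine of [j%:R * t], and [sinh_ge_id] applies. *)
Lemma geom_odd_le t j N : 0 < t -> (0 < j)%N ->
  \sum_(k < N) (expR (- t) ^+ k.*2.+1) ^+ j <= (2 * (j%:R * t))^-1.
Proof.
move=> t0 j0; set q := expR (- t) ^+ j.
have u0 : 0 < j%:R * t by rewrite mulr_gt0 // ltr0n.
have qE : q = expR (- (j%:R * t)) by rewrite -mulrN expRM_natl.
have qV : q^-1 = expR (j%:R * t) by rewrite qE expRN invrK.
have q0 : 0 < q by rewrite qE expR_gt0.
have q1 : q ^+ 2 < 1.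
  by rewrite exprn_ilt1 ?(ltW q0) // qE expR_lt1 oppr_lt0.
have -> : \sum_(k < N) (expR (- t) ^+ k.*2.+1) ^+ j = q * \sum_(k < N) (q ^+ 2) ^+ k.
  rewrite mulr_sumr; apply: eq_bigr => k _.
  by rewrite exprAC -/q exprS -mul2n exprM.
have e : (1 - q ^+ 2) * \sum_(k < N) (q ^+ 2) ^+ k = 1 - (q ^+ 2) ^+ N.
  by rewrite -[1 - (q ^+ 2) ^+ N]opprB subrX1; ring.
have sinh := sinh_ge_id _ _ (ltW u0); rewrite -qV -qE in sinh.
have s0 : 0 < q^-1 - q by apply: lt_le_trans sinh; rewrite mulr_gt0.
apply: (@le_trans _ _ (q^-1 - q)^-1); last first.
  by rewrite lef_pV2 // posrE // mulr_gt0.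
have -> : (q^-1 - q)^-1 = q / (1 - q ^+ 2).
  have d1 : 1 - q ^+ 2 != 0 by rewrite subr_eq0 gt_eqF.
  have -> : q^-1 - q = (1 - q ^+ 2) / q by field; rewrite gt_eqF.
  by rewrite invf_div.
rewrite ler_pM2l // -[_^-1]mul1r ler_pdivlMr ?subr_gt0 // mulrC e.
by rewrite gerBl exprn_ge0 // sqr_ge0.
Qed.

Lemma prod_distinct_le t N : 0 < t ->
  \prod_(1 <= k < N.+1) (1 + expR t ^- k) <= expR (pi ^+ 2 / (12 * t)).
Proof.
move=> t0; set x := expR (- t).
have x0 : 0 < x by apply: expR_gt0.
have x1 : x < 1 by rewrite expR_lt1 oppr_lt0.
have y01 k : 0 < x ^+ k.*2.+1 < 1 by rewrite exprn_gt0 // exprn_ilt1 // ltW.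
rewrite (eq_bigr (fun k => 1 + x ^+ k)); last first.
  by move=> k _; rewrite /x expRN exprVn.
set F := \prod_(1 <= k < _) _.
have F0 : 0 < F by apply: prodr_gt0 => k _; rewrite addr_gt0 ?exprn_gt0.
set Q := \prod_(k < N) (1 - x ^+ k.*2.+1).
have Q0 : 0 < Q by apply: prodr_gt0 => k _; rewrite subr_gt0; case/andP: (y01 k).
set C := pi ^+ 2 / (12 * t).
(* Cutting the logarithmic series at [J] leaves an error that, for fixed [N], vanishes as [J]
   grows. *)
have bound J : ln F <= C + (N%:R / (1 - x)) * x ^+ J.+1.
  have FQ : F <= Q^-1.
    by rewrite -[Q^-1]mul1r ler_pdivlMr // euler_prod_le1 // x0.
  rewrite -ler_expR lnK ?posrE //; apply: (le_trans FQ).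
  rewrite /Q -prodfV.
  pose a (k : nat) :=
    \sum_(1 <= j < J.+1) (x ^+ k.*2.+1) ^+ j / j%:R + x ^+ J.+1 / (1 - x).
  apply: (@le_trans _ _ (\prod_(k < N) expR (a k))).
    apply: ler_prod => k _; have [yk0 yk1] := andP (y01 k).
    rewrite invr_ge0 subr_ge0 (ltW yk1) /=.
    rewrite -[X in X <= _]lnK ?posrE ?invr_gt0 ?subr_gt0 // ler_expR.
    rewrite lnV ?posrE ?subr_gt0 //; have h := ln1B_ge _ J (y01 k).
    apply: (le_trans h).
    rewrite lerD2l; have xk : x ^+ k.*2.+1 <= x.
      by rewrite exprS ler_piMr ?(ltW x0) // exprn_ile1 ?ltW.
    apply: ler_pM.
    - by rewrite exprn_ge0 // ltW.
    - by rewrite invr_ge0 subr_ge0 ltW.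
    - by rewrite lerXn2r ?nnegrE // ltW.
    by rewrite lef_pV2 ?posrE ?subr_gt0 // lerD2l lerN2.
  rewrite -expR_sum ler_expR big_split /= sumr_const card_ord.
  rewrite -[_ / _ *+ N]mulr_natl mulrCA [_ * (_ / _)]mulrC.
  (* Summing over [k] first gives at most [(2 * (j%:R * t))^-1] for each [j]; the remaining [1 / j]
     produces the sum of inverse squares. *)
  rewrite lerD2r exchange_big /=.
  apply: (@le_trans _ _ ((2 * t)^-1 * \sum_(1 <= j < J.+1) (j%:R ^+ 2)^-1)).
    rewrite mulr_sumr; apply: ler_sum_nat => j /andP[j0 _].
    have j0R : 0 < j%:R :> R by rewrite ltr0n.
    rewrite -mulr_suml.
    have -> : (2 * t)^-1 * (j%:R ^+ 2)^-1 = (2 * (j%:R * t))^-1 / j%:R.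
      by field; rewrite !gt_eqF.
    by rewrite ler_pM2r ?invr_gt0 // geom_odd_le.
  have -> : C = (2 * t)^-1 * (pi ^+ 2 / 6).
    by rewrite /C; move: (pi) => p; field; rewrite gt_eqF.
  by rewrite ler_pM2l ?invr_gt0 ?mulr_gt0 // sum_inv_sqr_le.
rewrite -[F]lnK ?posrE // ler_expR.
have cv : (fun J => C + (N%:R / (1 - x)) * x ^+ J.+1) @ \oo --> C.
  rewrite -[X in _ --> X]addr0 -[X in _ --> _ + X](mulr0 (N%:R / (1 - x))).
  apply: cvgD; first exact: cvg_cst.
  apply: cvgMr; rewrite (cvg_shiftS (fun J => x ^+ J)).
  by apply: cvg_expr; rewrite gtr0_norm.
rewrite -(cvg_lim (@Rhausdorff R) cv).
apply: limr_ge; first by apply/cvg_ex; exists C.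
by near=> J; apply: bound.
Unshelve. all: by end_near.
Qed.

End PartitionProduct.

(** * Growth rates *)

Section Subadditive.
Variable R : realType.

(** The limit is the infimum of the quotients: Euclidean division of [n] by [m.+1] brings [l n / n]
    close to any given quotient. *)
Lemma fekete (l : nat -> R) : (forall n, 0 <= l n) ->
  (forall m n, l (m + n)%N <= l m + l n) -> cvgn (fun n => l n / n%:R).
Proof.
move=> l0 lD.
pose E := [set l m.+1 / m.+1%:R | m in setT].
have E0 : lbound E 0 by move=> _ [m _ <-]; rewrite divr_ge0.
have hE : has_inf E by split; [exists (l 1 / 1), 0%N | exists 0].
have qD q k m : l (k + q * m)%N <= l k + q%:R * l m.
  elim: q => [|q IH]; first by rewrite mul0n addn0 mul0r addr0.
  rewrite mulSn addnCA addnC -natr1 mulrDl mul1r addrA.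
  by apply: (le_trans (lD _ _)); rewrite lerD2r.
have lr k : l k <= l 0 + k%:R * l 1.
  by have := qD k 0%N 1; rewrite muln1 add0n.
apply/cvg_ex; exists (inf E); apply/cvgrPdist_le => e e0.
have [_ [m _ <-] lm] := inf_adherent (divr_gt0 e0 (ltr0Sn R 1)) hE.
(* [M] bounds [l] at every remainder modulo [m.+1]. *)
pose M := l 0%N + m.+1%:R * l 1%N.
near=> n.
have n0 : 0 < n%:R :> R by rewrite ltr0n; near: n; exists 1%N.
have lo : inf E <= l n / n%:R.
  apply: ge_inf; first by exists 0.
  by exists n.-1 => //; rewrite prednK // -(ltr0n R).
have hi : l n <= n%:R * (l m.+1 / m.+1%:R) + M.
  rewrite {1}(divn_eq n m.+1) addnC; apply: (le_trans (qD _ _ _)).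
  rewrite addrC lerD //.
    rewrite mulrCA [X in X <= _]mulrC ler_wpM2l // ler_pdivlMr ?ltr0n // -natrM ler_nat.
    exact: leq_divM.
  apply: (le_trans (lr _)); rewrite lerD2l ler_wpM2r // ler_nat ltnW //.
  exact: ltn_pmod.
have Mn : M / n%:R <= e / 2.
  rewrite ler_pdivrMr // mulrC -ler_pdivrMr ?divr_gt0 //.
  by near: n; exact: nbhs_infty_ger.
rewrite distrC ger0_norm ?subr_ge0 // lerBlDl.
apply: (@le_trans _ _ (l m.+1 / m.+1%:R + M / n%:R)).
  by rewrite ler_pdivrMr // mulrDl mulrC divfK ?gt_eqF.
by rewrite [in leRHS](splitr e) addrA lerD // ltW.
Unshelve. all: by end_near.
Qed.

(* Every term of the sequence dominates [b n `^ n^-1], because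
   [b n ^+ m <= b (m * n) <= c m ^+ n]. *)
Lemma supermult_le_growth (b c : nat -> R) n : (0 < n)%N ->
  (forall k, 1 <= b k) -> (forall k, b k <= c k) ->
  (forall i j, b i * b j <= b (i + j)%N) ->
  (forall i j, c (i + j)%N <= c i * c j) ->
  b n <= (limn (fun k : nat => c k `^ k%:R^-1)) ^+ n.
Proof.
move=> n0 b1 bc bM cM.
have c1 k : 1 <= c k := le_trans (b1 k) (bc k).
have c0 k : 0 < c k := lt_le_trans ltr01 (c1 k).
have b0 k : 0 < b k := lt_le_trans ltr01 (b1 k).
have uE : (fun k : nat => c k `^ k%:R^-1) = expR \o (fun k => ln (c k) / k%:R).
  by apply/funext => k /=; rewrite /powR gt_eqF // mulrC.
(* Convergence comes from [fekete] applied to [ln (c k)], which is nonnegative and subadditive. *)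
have cv : cvgn (fun k : nat => c k `^ k%:R^-1).
  rewrite uE; have /cvg_ex[L cvL] : cvgn (fun k => ln (c k) / k%:R).
    apply: fekete => [k|i j]; first exact: ln_ge0.
    by rewrite -lnM ?posrE // ler_ln ?posrE ?mulr_gt0.
  apply/cvg_ex; exists (expR L).
  exact: (continuous_cvg _ (@continuous_expR R L) cvL).
have bX m : b n ^+ m.+1 <= b (m.+1 * n)%N.
  elim: m => [|m IH]; first by rewrite mul1n.
  rewrite exprS mulSn; apply: le_trans (bM _ _).
  by rewrite ler_pM2l.
have cX m k : c (k.+1 * m)%N <= c m ^+ k.+1.
  elim: k => [|k IH]; first by rewrite mul1n.
  by rewrite exprS mulSn; apply: (le_trans (cM _ _)); rewrite ler_pM2l.
have lb : b n `^ n%:R^-1 <= limn (fun k : nat => c k `^ k%:R^-1).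
  apply: limr_ge => //; exists 1%N => // m /= m0.
  have h : b n ^+ m <= c m ^+ n.
    have := bX m.-1; have := cX m n.-1; rewrite !prednK // => hc hb.
    by apply: (le_trans hb); apply: le_trans hc; rewrite mulnC.
  have -> : b n `^ n%:R^-1 = (b n ^+ m) `^ ((m * n)%:R^-1).
    rewrite -powR_mulrn ?ltW // -powRrM natrM invfM mulrA divff ?mul1r //.
    by rewrite pnatr_eq0 -lt0n.
  have -> : c m `^ m%:R^-1 = (c m ^+ n) `^ ((m * n)%:R^-1).
    rewrite -powR_mulrn ?ltW // -powRrM natrM invfM mulrCA divff ?mulr1 //.
    by rewrite pnatr_eq0 -lt0n.
  by rewrite ge0_ler_powR ?nnegrE ?invr_ge0 ?exprn_ge0 // ltW.
apply: le_trans (_ : (b n `^ n%:R^-1) ^+ n <= _).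
  have nn : n%:R != 0 :> R by rewrite pnatr_eq0 -lt0n.
  by rewrite -powR_mulrn ?powR_ge0 // -powRrM mulVf // powRr1 // ltW.
by rewrite lerXn2r ?nnegrE ?powR_ge0 // (le_trans _ lb) ?powR_ge0.
Qed.

End Subadditive.

(** * Choice of the parameter and conclusion *)

Lemma expR_absorb (R : realType) (a b : R) : 0 <= a -> a < b ->
  exists n0 : nat, forall n : nat, (n0 <= n)%N ->
    n.+1%:R * expR (a * Num.sqrt n.+1%:R) <= expR (b * Num.sqrt n%:R).
Proof.
move=> a0 ab; pose e := b - a; have e0 : 0 < e by rewrite subr_gt0.
have e30 : 0 < e ^+ 3 by rewrite exprn_gt0.
(* For [s >= K] the cubic term [(e * s) ^+ 3 / 6] of [expR (e * s)] dominates [2 * s ^+ 2 * expR a];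
   the summand [1] ensures [s >= 1], hence [n.+1 <= 2 * s ^+ 2]. *)
pose K := 12 * expR a / e ^+ 3 + 1.
have K1 : 1 <= K by rewrite lerDr divr_ge0 ?mulr_ge0 ?expR_ge0 // ltW.
exists (Num.bound (K ^+ 2)) => n nK.
set s := Num.sqrt n%:R.
have nE : n%:R = s ^+ 2 by rewrite sqr_sqrtr.
have Ks : K <= s.
  have K0 : 0 <= K by apply: le_trans K1.
  rewrite -(ler_pXn2r (ltn0Sn 1)) ?nnegrE ?sqrtr_ge0 // -nE.
  apply: le_trans (ltW (archi_boundP _)) _; first by rewrite sqr_ge0.
  by rewrite ler_nat.
have s1 : 1 <= s by apply: le_trans Ks.
have s0 : 0 < s by apply: lt_le_trans s1.
(* Replacing [n.+1] by [n] under the root costs at most the factor [expR a]. *)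
have rs : Num.sqrt n.+1%:R <= s + 1.
  rewrite -[s + 1]ger0_norm; last by lra.
  by rewrite -sqrtr_sqr ler_sqrt ?sqr_ge0 // -natr1 nE; nra.
have n2 : n.+1%:R <= 2 * s ^+ 2 by rewrite -natr1 nE; nra.
have key : 2 * s ^+ 2 * expR a <= expR (e * s).
  apply: le_trans (expR_ge1Dxn 2 (ltW (mulr_gt0 e0 s0))).
  have h : 12 * expR a <= e ^+ 3 * s.
    rewrite [e ^+ 3 * s]mulrC -ler_pdivrMr //; apply: le_trans Ks; rewrite /K; lra.
  rewrite (_ : 3`!%:R = 6) // exprMn.
  have := ler_wpM2l (sqr_ge0 s) h; move: (expR a) (e ^+ 3) => u v; nra.
have -> : b * s = e * s + a * s by rewrite /e; ring.
rewrite expRD; apply: (@le_trans _ _ (2 * s ^+ 2 * (expR a * expR (a * s)))).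
  apply: ler_pM => //.
  by rewrite -expRD ler_expR; nra.
by rewrite mulrA ler_wpM2r ?expR_ge0.
Qed.

Lemma saw_le_bridge_expR (R : realType) d n :
  (cnt d n (@saw d))%:R <= n.+1%:R *
    expR (pi * Num.sqrt (2 / 3) * Num.sqrt n.+1%:R)
    * (cnt d n.+1 (@bridge d))%:R :> R.
Proof.
have p0 := pi_gt0 R; set a := pi * Num.sqrt (2 / 3); set r := Num.sqrt n.+1%:R.
have r0 : 0 < r by rewrite sqrtr_gt0 ltr0n.
have rr : n.+1%:R = r ^+ 2 by rewrite sqr_sqrtr.
have a0 : 0 < a by rewrite mulr_gt0 // sqrtr_gt0 divr_gt0.
have aa : pi ^+ 2 = 3 / 2 * a ^+ 2.
  by rewrite exprMn sqr_sqrtr ?divr_ge0 //; move: (pi) => p; field.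
(* This [t] minimises [n.+1 * t + pi ^+ 2 / (6 * t)]: both terms equal [a * r / 2]. *)
pose t := a / (2 * r).
have t0 : 0 < t by rewrite divr_gt0 // mulr_gt0.
have z1 : 1 <= expR t by rewrite -expR0 ler_expR ltW.
apply: (le_trans (saw_le_bridge _ _ (expR t) n z1)).
rewrite ler_wpM2r // ler_wpM2l // -expRM_natl.
have Pt := prod_distinct_le _ _ n.+1 t0.
have P0 : 0 <= \prod_(1 <= k < n.+2) (1 + expR t ^- k).
  by apply: prodr_ge0 => k _; rewrite addr_ge0 // invr_ge0 exprn_ge0 // expR_ge0.
apply: (@le_trans _ _ (expR (n.+1%:R * t) * expR (pi ^+ 2 / (12 * t)) ^+ 2)).
  by rewrite ler_wpM2l ?expR_ge0 // lerXn2r ?nnegrE ?expR_ge0.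
rewrite -expRM_natl -expRD ler_expR rr aa /t.
rewrite (_ : _ + _ = a * r) //; field; by rewrite !gt_eqF.
Qed.

Theorem theorem2p6 (R : realType) (B : R) (hB : pi * Num.sqrt (2 / 3) < B) :
  exists n0 : nat, forall d : nat, (2 <= d)%N -> forall n : nat, (n0 <= n)%N ->
    (saw_count d n)%:R <= (bridge_count d n.+1)%:R * expR (B * Num.sqrt n%:R)
    /\ (bridge_count d n.+1)%:R * expR (B * Num.sqrt n%:R)
       <= connective_constant R d ^+ n.+1 * expR (B * Num.sqrt n%:R).
Proof.
have p0 := pi_gt0 R.
(* The threshold depends only on [B], which gives uniformity in the dimension. *)
have [|n0 n0P] := expR_absorb _ _ _ _ hB.
  by rewrite mulr_ge0 ?sqrtr_ge0 // ltW.
exists n0 => -[//|d] d2 n nn0; split.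
  rewrite saw_countE bridge_countE.
  apply: (le_trans (saw_le_bridge_expR R d n)).
  by rewrite mulrC ler_wpM2l // n0P.
rewrite ler_wpM2r ?expR_ge0 // bridge_countE /connective_constant.
under eq_fun do rewrite saw_countE.
apply: (@supermult_le_growth R (fun k => (cnt d k (@bridge d))%:R)
  (fun k => (cnt d k (@saw d))%:R) n.+1) => //.
- by move=> k; rewrite ler1n cnt_bridge_ge1.
- exact: bridge_sub_saw.
- exact: bridge_concat.
exact: saw_cut.
Qed.
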